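(* Every connected $(d,r)$-regular hypergraph $H$ has a right-sided Ramanujan $2$-covering, i.e. there is a $2$-cover $\bar H$ of $H$ all of whose new eigenvalues are at most $r-2+2\sqrt{(d-1)(r-1)}$.
   Context: A hypergraph $H=(V,E)$ has a finite vertex set and a finite family of subsets of $V$ (edges). It is $(d,r)$-regular if every edge has exactly $r\ge 2$ vertices and every vertex lies in exactly $d$ edges; connected means any two vertices are joined by a walk through edges. The adjacency matrix $A(H)$ has $(u,v)$-entry the number of edges containing both $u$ and $v$ for $u\neq v$ and $0$ on the diagonal; eigenvalues of $H$ are those of $A(H)$ with multiplicity. A covering projection $\varpi:V(\bar H)\to V(H)$ is a surjective map sending each edge of $\bar H$ bijectively onto an edge of $H$ such that for each $v\in V(H)$ and each $\bar v\in\varpi^{-1}(v)$ the induced map from edges of $\bar H$ containing $\bar v$ to edges of $H$ containing $v$ is a bijection. For connected $H$, every vertex has the same number $k$ of preimages and $\bar H$ is called a $k$-cover. For a $2$-cover $\bar H$ of $H$, the multiset of eigenvalues of $A(\bar H)$ contains the multiset of eigenvalues of $A(H)$; the new eigenvalues of $\bar H$ are the elements of the multiset difference (the eigenvalues of $\bar H$ with those of $H$ removed, with multiplicity).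
   Formalization: The formal statement assumes d ≥ 2: for d = 1, H is a single edge whose only 2-cover is two disjoint copies, with new eigenvalue r−1 exceeding the bound r−2, and for d = 0 the bound contains the square root of a negative number. *)

(* Defs.v *)
From HB Require Import structures.
From mathcomp Require Import all_boot all_order all_algebra.
From mathcomp Require Import reals.

Set Implicit Arguments.
Unset Strict Implicit.
Unset Printing Implicit Defensive.

Import GRing.Theory Num.Theory.
Local Open Scope ring_scope.

(* The edges form an indexed family of vertex sets; set systems are the
   case where [edge] is injective. *)
Record hypergraph := Hypergraph {
  vertex : finType;
  hyperedge : finType;
  edge : hyperedge -> {set vertex}
}.

Section Hypergraph.

Variable H : hypergraph.

Definition edges_at (v : vertex H) : {set hyperedge H} :=
  [set e | v \in edge e].

Definition regular (d r : nat) : Prop :=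
  [/\ (2 <= r)%N,
      forall e : hyperedge H, #|edge e| = r
    & forall v : vertex H, #|edges_at v| = d].

Definition adjacent : rel (vertex H) :=
  [rel u v | [exists e : hyperedge H, (u \in edge e) && (v \in edge e)]].

Definition connected : Prop := forall u v : vertex H, connect adjacent u v.

(* Rows and columns are indexed by the vertices through [enum_val]. *)
Definition adjacency_mx (R : realType) : 'M[R]_#|vertex H| :=
  \matrix_(i, j)
    (if i == j then 0
     else #|edges_at (enum_val i) :&: edges_at (enum_val j)|%:R).

Definition eigenvalue_mult (R : realType) (x : R) : nat :=
  mup x (char_poly (adjacency_mx R)).

End Hypergraph.

Definition bij_onto (S T : finType) (f : S -> T) (A : {set S}) (B : {set T}) :=
  {in A &, injective f} /\ f @: A = B.

(* When the edges of H are pairwise distinct as vertex sets, the edge map [g]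
   is determined by the vertex map [f]. *)
Definition covering_projection (H' H : hypergraph)
    (f : vertex H' -> vertex H) : Prop :=
  (forall v : vertex H, exists v' : vertex H', f v' = v) /\
  exists g : hyperedge H' -> hyperedge H,
    (forall e' : hyperedge H', bij_onto f (edge e') (edge (g e'))) /\
    (forall v' : vertex H', bij_onto g (edges_at v') (edges_at (f v'))).

Definition is_cover (k : nat) (H' H : hypergraph) : Prop :=
  exists f : vertex H' -> vertex H,
    covering_projection f /\
    forall v : vertex H, #|[set v' | f v' == v]| = k.

(* Membership in the multiset difference of the two spectra. *)
Definition new_eigenvalue (R : realType) (H' H : hypergraph) (x : R) : Prop :=
  (0 < eigenvalue_mult H' x - eigenvalue_mult H x)%N.

(* Main.v *)
Require Import Defs.
From mathcomp Require Import all_boot all_order all_algebra.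
From mathcomp Require Import reals.
From mathcomp Require Import perm boolp complex ring lra.
Set Implicit Arguments.
Unset Strict Implicit.
Unset Printing Implicit Defensive.
Import Order.TTheory GRing.Theory Num.Theory.
Local Open Scope ring_scope.

(** A 2-cover of [H] is a signing of its vertex-edge incidences, and its new
    eigenvalues are those of [N - d], where [N] is the sum over the edges [e] of
    [b_e b_e^T] and [b_e] is the vector of signs on [e].  So it suffices to find
    signs for which [det (diag y - N) > 0] as soon as all [y_v] exceed
    [(a + c) ^ 2], with [a = sqrt (d - 1)] and [c = sqrt (r - 1)].

    Averaging [det (X - b_e b_e^T)] over the signs of [b_e] amounts to applying
    [T_e = 1 - \sum_(v in e) d/dy_v] to [det X], as a function of the diagonal.
    Averaging over all signs gives the matching polynomial of the incidence
    graph, whose positivity for [y_v > (a + c) ^ 2] is the Heilmann-Lieb argument.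

    The signs are then fixed one edge at a time (Marcus, Spielman, Srivastava).
    Let [q] and [p] be the images of [det (diag y - M)] and
    [b^T adj (diag y - M) b] under the operators of the remaining edges, so that
    the polynomial left after the choice of [b] is [q - p].  These operators
    preserve stability, hence [q + t p] has no zero with [Im y_v > 0] and
    [Im t >= 0]; this forces [p / q] to be nonincreasing in each [y_v].  A sign
    vector that does at least as well as the average at the corner
    [(x0, ..., x0)] is therefore good on the whole orthant [y >= x0]. *)

(** * Edge operators on multiaffine functions *)

Section EdgeOperators.

Variables (K : comNzRingType) (n : nat).
Implicit Types (G F : 'rV[K]_n -> K) (e : {set 'I_n}) (s : seq {set 'I_n}).

(* On multiaffine functions the unit difference is the partial derivative. *)
Definition pdiff (v : 'I_n) G (y : 'rV[K]_n) : K := G (y + delta_mx 0 v) - G y.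

Definition edge_op e G (y : 'rV[K]_n) : K := G y - \sum_(v in e) pdiff v G y.

Definition edge_ops s G := foldl (fun F e => edge_op e F) G s.

Definition multiaffine G :=
  forall y v t, G (y + t *: delta_mx 0 v) = G y + t * pdiff v G y.

Lemma eq_pdiff v F G : F =1 G -> pdiff v F =1 pdiff v G.
Proof. by move=> eFG y; rewrite /pdiff !eFG. Qed.

Lemma eq_edge_op e F G : F =1 G -> edge_op e F =1 edge_op e G.
Proof.
move=> eFG y; rewrite /edge_op eFG; congr (_ - _).
by apply: eq_bigr => v _; apply: eq_pdiff.
Qed.

Lemma eq_edge_ops s F G : F =1 G -> edge_ops s F =1 edge_ops s G.
Proof. by elim: s F G => //= e s IH F G eFG; apply/IH/eq_edge_op. Qed.

Lemma pdiffC u v G : pdiff u (pdiff v G) =1 pdiff v (pdiff u G).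
Proof. by move=> y; rewrite /pdiff (addrAC y); ring. Qed.

Lemma pdiff_edge_op v e G : pdiff v (edge_op e G) =1 edge_op e (pdiff v G).
Proof.
move=> y; rewrite [in RHS]/edge_op.
have -> : \sum_(u in e) pdiff u (pdiff v G) y =
  \sum_(u in e) (pdiff u G (y + delta_mx 0 v) - pdiff u G y).
  by apply: eq_bigr => u _; apply: pdiffC.
by rewrite sumrB /pdiff /edge_op; ring.
Qed.

Lemma edge_opC e f G : edge_op e (edge_op f G) =1 edge_op f (edge_op e G).
Proof.
move=> y; rewrite {1}/edge_op [in RHS]/edge_op.
rewrite (eq_bigr _ (fun u _ => pdiff_edge_op u f G y)).
rewrite [in RHS](eq_bigr _ (fun u _ => pdiff_edge_op u e G y)) /edge_op !sumrB.
rewrite [in RHS]exchange_big /=.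
have -> : \sum_(v in e) \sum_(u in f) pdiff u (pdiff v G) y =
  \sum_(v in e) \sum_(u in f) pdiff v (pdiff u G) y.
  by apply: eq_bigr => v _; apply: eq_bigr => u _; apply: pdiffC.
by ring.
Qed.

Lemma edge_opsC s e G : edge_ops s (edge_op e G) =1 edge_op e (edge_ops s G).
Proof.
elim: s G => [|f s IH] G y //=.
by rewrite -IH; apply: eq_edge_ops; apply: edge_opC.
Qed.

Lemma edge_ops_perm s1 s2 G : perm_eq s1 s2 -> edge_ops s1 G =1 edge_ops s2 G.
Proof.
elim: s1 s2 G => [|e s1 IH] s2 G.
  by rewrite perm_sym => /perm_nilP ->.
move=> eqs y; have es2 : e \in s2 by rewrite -(perm_mem eqs) mem_head.
case/splitPr: s2 / es2 eqs => t1 t2 eqs.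
have {}eqs : perm_eq s1 (t1 ++ t2).
  by rewrite -(perm_cons e) (permPl eqs) perm_catC /= perm_cons perm_catC.
rewrite /= (IH _ _ eqs) /edge_ops !foldl_cat /= -/(edge_ops t2).
by apply: (@eq_edge_ops t2) => z; apply: (@edge_opsC t1).
Qed.

Lemma edge_op_sum (I : finType) (P : pred I) (c : I -> K) (G : I -> 'rV[K]_n -> K) e :
  edge_op e (fun y => \sum_(i | P i) c i * G i y)
    =1 fun y => \sum_(i | P i) c i * edge_op e (G i) y.
Proof.
move=> y; rewrite /edge_op /pdiff.
under [X in _ - X]eq_bigr do rewrite -sumrB.
rewrite exchange_big -sumrB; apply: eq_bigr => i _.
by rewrite mulrBr mulr_sumr; under eq_bigr do rewrite -mulrBr.
Qed.

Lemma edge_ops_sum (I : finType) (P : pred I) (c : I -> K) (G : I -> 'rV[K]_n -> K) s :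
  edge_ops s (fun y => \sum_(i | P i) c i * G i y)
    =1 fun y => \sum_(i | P i) c i * edge_ops s (G i) y.
Proof.
elim: s G => [|e s IH] G y //=; rewrite -IH.
by apply: eq_edge_ops; apply: edge_op_sum.
Qed.

Lemma edge_ops_affine c F G s :
  edge_ops s (fun y => F y + c * G y)
    =1 fun y => edge_ops s F y + c * edge_ops s G y.
Proof.
move=> y.
have /(_ y) := @edge_ops_sum bool predT (fun b => if b then 1 else c)
   (fun b => if b then F else G) s.
rewrite big_bool /= mul1r => <-; apply: eq_edge_ops => z.
by rewrite big_bool /= mul1r.
Qed.

Lemma multiaffine_pdiff v G : multiaffine G -> multiaffine (pdiff v G).
Proof.
by move=> aG y u t; rewrite {1}/pdiff (addrAC y) !aG /pdiff (addrAC y); ring.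
Qed.

Lemma pdiff_multiaffine_id v G y t :
  multiaffine G -> pdiff v G (y + t *: delta_mx 0 v) = pdiff v G y.
Proof.
move=> aG; rewrite /pdiff aG -addrA -{2}[delta_mx 0 v]scale1r -scalerDl aG.
by rewrite /pdiff; ring.
Qed.

Lemma multiaffine_edge_op e G : multiaffine G -> multiaffine (edge_op e G).
Proof.
move=> aG y v t; rewrite pdiff_edge_op /edge_op aG.
under eq_bigr do rewrite (multiaffine_pdiff _ aG) pdiffC.
by rewrite big_split -mulr_sumr /=; ring.
Qed.

Lemma multiaffine_edge_ops s G : multiaffine G -> multiaffine (edge_ops s G).
Proof. by elim: s G => //= e s IH G aG; apply/IH/multiaffine_edge_op. Qed.

End EdgeOperators.

(** Taken with [f] the embedding of the reals into the complex numbers, this carries real functions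
    to the complex ones, for which stability is stated. *)
Lemma edge_ops_map (K L : comNzRingType) (f : {rmorphism K -> L}) n
    (s : seq {set 'I_n}) (G : 'rV[K]_n -> K) (G' : 'rV[L]_n -> L) :
  (forall y, f (G y) = G' (map_mx f y)) ->
  forall y, f (edge_ops s G y) = edge_ops s G' (map_mx f y).
Proof.
elim: s G G' => //= e s IH G G' eG; apply: IH => y.
rewrite /edge_op rmorphB eG rmorph_sum; congr (_ - _).
by apply: eq_bigr => v _; rewrite /pdiff rmorphB !eG map_mxD map_delta_mx.
Qed.

(** * Stability *)

Section Stability.

Variables (R : rcfType) (n : nat).
Local Notation C := R[i].
Local Notation Re := (@complex.Re R).
Local Notation Im := (@complex.Im R).
Implicit Types (G Q P : 'rV[C]_n -> C) (z : 'rV[C]_n).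

Definition upper_half z := forall v, 0 < Im (z 0 v).

Definition stable G := multiaffine G /\ forall z, upper_half z -> G z != 0.

Lemma Im_add (x y : C) : Im (x + y) = Im x + Im y.
Proof. by move: x y => [a b] [c d]. Qed.

Lemma Im_sum (I : finType) (A : pred I) (F : I -> C) :
  Im (\sum_(i | A i) F i) = \sum_(i | A i) Im (F i).
Proof. by apply: (big_morph _ Im_add). Qed.

Lemma Im_mulcJ_self (x : C) : Im (x * x^*%C) = 0.
Proof. by case: x => a b /=; ring. Qed.

Lemma mulcJ_self (x : C) : x * x^*%C = (Re x ^+ 2 + Im x ^+ 2)%:C%C.
Proof.
case: x => a b; apply/eqP; rewrite eq_complex /=.
by apply/andP; split; apply/eqP; ring.
Qed.

Lemma norm2_gt0 (x : C) : x != 0 -> 0 < Re x ^+ 2 + Im x ^+ 2.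
Proof.
case: x => a b; rewrite eq_complex /= negb_and => ab0.
rewrite lt_def paddr_eq0 ?sqr_ge0 // !sqrf_eq0 negb_and ab0.
by rewrite addr_ge0 ?sqr_ge0.
Qed.

(** The only root in [t] is [- a / b], whose imaginary part has the sign opposite to that of [a]
    times the conjugate of [b]. *)
Lemma Im_gt0_affine_neq0 (a b : C) : b != 0 ->
  (forall t, 0 <= Im t -> a + t * b != 0) -> 0 < Im (a * b^*%C).
Proof.
move=> b0 h; rewrite ltNge; apply/negP => le0.
pose N := Re b ^+ 2 + Im b ^+ 2; have N0 : 0 < N := norm2_gt0 b0.
have /h/eqP[] : 0 <= Im ((- N^-1)%:C%C * (a * b^*%C)).
  case: (a * b^*%C) le0 => x y /= le0.
  by rewrite mul0r addr0 mulNr oppr_ge0 pmulr_rle0 ?invr_gt0.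
have -> : (- N^-1)%:C%C * (a * b^*%C) * b = - (N^-1 * N)%:C%C * a.
  by rewrite rmorphM rmorphN /= -mulcJ_self; ring.
by rewrite mulVf ?gt_eqF // rmorph1 mulN1r subrr.
Qed.

Lemma Im_ge0_affine_neq0 (a b : C) :
  (forall t, 0 <= Im t -> a + t * b != 0) -> 0 <= Im (a * b^*%C).
Proof.
have [-> _|b0 h] := eqVneq b 0; first by rewrite rmorph0 mulr0.
by rewrite ltW // Im_gt0_affine_neq0.
Qed.

Lemma upper_half_shift z v (t : C) :
  upper_half z -> 0 <= Im t -> upper_half (z + t *: delta_mx 0 v).
Proof.
move=> uz t0 u; rewrite !mxE eqxx /= Im_add.
have [_|_] := eqVneq u v; rewrite ?mulr1 ?mulr0 /= ?addr0 //.
by rewrite ltr_pwDl.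
Qed.

(** If the image vanished at [z], then [G z] would be the sum of its derivatives over [e]. Multiply
    the conjugate of this equation by [G z]: the left side is real, while each term on the right has
    nonnegative imaginary part, positive unless the derivative is 0. So all the derivatives vanish,
    and [G z] with them. *)
Lemma stable_edge_op e G : stable G -> stable (edge_op e G).
Proof.
move=> [aG sG]; split=> [|z uz]; first exact: multiaffine_edge_op.
have hv v t : 0 <= Im t -> G z + t * pdiff v G z != 0.
  by move=> t0; rewrite -aG sG //; apply: upper_half_shift.
rewrite /edge_op subr_eq0; apply/negP => /eqP eG.
have := Im_mulcJ_self (G z).
rewrite {2}eG rmorph_sum /= mulr_sumr Im_sum => /psumr_eq0P h.
have /negP[] := sG z uz; rewrite eG big1 // => v ve.
apply/eqP/negPn/negP => d0.
have := Im_gt0_affine_neq0 d0 (hv v); rewrite h ?ltxx // => u _.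
exact: Im_ge0_affine_neq0 (hv u).
Qed.

Lemma stable_edge_ops s G : stable G -> stable (edge_ops s G).
Proof. by elim: s G => //= e s IH G sG; apply/IH/stable_edge_op. Qed.

(** An algebraic substitute for letting [x] tend to 0 from above. *)
Lemma quadratic_ge0_at0 (a b c : R) :
  (forall x, 0 < x -> 0 <= a + x * b + x ^+ 2 * c) -> 0 <= a.
Proof.
move=> h; rewrite leNgt; apply/negP => a0.
pose m := 1 + `|b| + `|c|.
have m1 : 1 <= m by rewrite /m -addrA lerDl addr_ge0.
have ma : 0 < m - a by lra.
(* For this [x], which is at most 1, the quadratic is at most [a + x * (m - 1) = x * a - x < 0]. *)
pose x := - a / (m - a).
have x0 : 0 < x by rewrite divr_gt0 // oppr_gt0.
have x1 : x <= 1 by rewrite ler_pdivrMr //; lra.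
have xm : x * (m - a) = - a by rewrite divfK ?gt_eqF.
have xx : x ^+ 2 <= x by rewrite expr2 ler_piMl // ltW.
have hb : x * b <= x * `|b| by rewrite ler_wpM2l ?ler_norm // ltW.
have hc : x ^+ 2 * c <= x * `|c|.
  apply: (le_trans (_ : _ <= x ^+ 2 * `|c|)).
    by rewrite ler_wpM2l ?ler_norm ?sqr_ge0.
  by rewrite ler_wpM2r.
have := h x x0; have : x * a < 0 by rewrite pmulr_rlt0.
move: xm; rewrite /m mulrBr !mulrDr; lra.
Qed.

(** Induction on the number of real coordinates: raising one of them by [x] times the imaginary unit
    makes the imaginary part a quadratic polynomial in [x], nonnegative for [x > 0] and hence at
    0. *)
Lemma Im_ge0_closed_upper_half Q P : multiaffine Q -> multiaffine P ->
  (forall z t, upper_half z -> 0 <= Im t -> Q z + t * P z != 0) ->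
  forall z, (forall v, 0 <= Im (z 0 v)) -> 0 <= Im (Q z * (P z)^*%C).
Proof.
move=> aQ aP h z; have [k] := ubnP #|[set v | Im (z 0 v) == 0]|.
elim: k z => // k IH z; rewrite ltnS => leK z0.
have [/eqP|[v]] := set_0Vmem [set v | Im (z 0 v) == 0].
  move/eqP/setP => e; apply: Im_ge0_affine_neq0 => t; apply: h => v.
  by have := e v; rewrite !inE lt_def z0 andbT => ->.
rewrite inE => /eqP zv.
have {}IH x : 0 < x -> 0 <= Im (Q (z + (x *i)%C *: delta_mx 0 v) *
    (P (z + (x *i)%C *: delta_mx 0 v))^*%C).
  move=> x0; apply: IH; last first.
    move=> u; rewrite !mxE eqxx /= Im_add addr_ge0 //.
    by have [_|_] := eqVneq u v; rewrite ?mulr1 ?mulr0 //= ltW.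
  apply: leq_trans leK; apply/proper_card/properP; split; last first.
    exists v; rewrite !inE ?zv // !mxE !eqxx /= mulr1 Im_add zv add0r /=.
    by rewrite gt_eqF.
  apply/subsetP=> u; rewrite !inE !mxE eqxx /= Im_add.
  have [-> _|_] := eqVneq u v; first by rewrite zv.
  by rewrite mulr0 addr0.
move: IH.
set q := Q z; set p := P z; set q1 := pdiff v Q z; set p1 := pdiff v P z.
move=> IH.
apply: (@quadratic_ge0_at0 _ (Im ('i%C * q1 * p^*%C + q * ('i%C * p1)^*%C))
                             (Im (q1 * p1^*%C))) => x x0.
have := IH x x0; rewrite aQ aP -/q -/p -/q1 -/p1.
case: (q) (p) (q1) (p1) => [a b] [c d] [e f] [g i] /=.
by congr (0 <= _); ring.
Qed.

(** At [y + 'i *: delta_mx 0 v], multiaffinity turns [Q] and [P] into [q + i q_v] and [p + i p_v],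
    where the index denotes the derivative. The first times the conjugate of the second has
    imaginary part [p q_v - q p_v]. *)
Lemma rayleigh_real (q p : 'rV[R]_n -> R) Q P v y :
  multiaffine Q -> multiaffine P ->
  (forall x, (q x)%:C%C = Q (map_mx (real_complex R) x)) ->
  (forall x, (p x)%:C%C = P (map_mx (real_complex R) x)) ->
  (forall z t, upper_half z -> 0 <= Im t -> Q z + t * P z != 0) ->
  q y * pdiff v p y <= p y * pdiff v q y.
Proof.
move=> aQ aP eQ eP h; pose yC := map_mx (real_complex R) y.
have pdC (g : 'rV[R]_n -> R) G :
    (forall x, (g x)%:C%C = G (map_mx (real_complex R) x)) ->
    pdiff v G yC = (pdiff v g y)%:C%C.
  by move=> e; rewrite /pdiff rmorphB /= !e map_mxD map_delta_mx.
have := Im_ge0_closed_upper_half aQ aP h (z := yC + 'i%C *: delta_mx 0 v).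
rewrite aQ aP !(pdC _ _ eQ) !(pdC _ _ eP) -eQ -eP.
have z0 u : 0 <= Im ((yC + 'i%C *: delta_mx 0 v) 0 u).
  rewrite !mxE eqxx /= Im_add /= add0r.
  by have [_|_] := eqVneq u v; rewrite ?mulr1 ?mulr0 /= ?ler01.
by move/(_ z0) => /=; lra.
Qed.

(** A nonzero row [u] in the kernel would give [\sum_v z_v |u_v|^2 - u M u^H + t |u b|^2 = 0]. The
    middle term is real because [M] is real symmetric, and the other terms have positive total
    imaginary part. *)
Lemma det_diag_rank1_neq0 (M : 'M[R]_n) (b : 'cV[R]_n) z (t : C) :
  M^T = M -> upper_half z -> 0 <= Im t ->
  \det (diag_mx z - map_mx (real_complex R) M
        + t *: (map_mx (real_complex R) b *m (map_mx (real_complex R) b)^T)) != 0.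
Proof.
move=> sM uz t0; apply/negP => /det0P[u u0].
set MC := map_mx _ M; set bC := map_mx _ b => uX.
pose uH := (map_mx (@conjc R) u)^T.
have real_conj m p (A : 'M[R]_(m, p)) :
    map_mx (@conjc R) (map_mx (real_complex R) A) = map_mx (real_complex R) A.
  by apply/matrixP=> i j; rewrite !mxE conjc_real.
have e1 : (u *m diag_mx z *m uH) 0 0 = \sum_v z 0 v * (u 0 v * (u 0 v)^*%C).
  by rewrite mxE; apply: eq_bigr => v _; rewrite mul_mx_diag !mxE; ring.
have e2 : Im ((u *m MC *m uH) 0 0) = 0.
  pose A := u *m MC *m uH; have : map_mx (@conjc R) A = A^T.
    rewrite !map_mxM !trmx_mul trmxK real_conj.
    have -> : MC^T = MC by rewrite /MC -[in RHS]sM; apply/matrixP=> i j; rewrite !mxE.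
    rewrite -mulmxA; congr (_ *m (_ *m _)).
    by apply/matrixP=> i j; rewrite !mxE /= conjcK.
  move/matrixP/(_ 0 0); rewrite [LHS]mxE [RHS]mxE.
  by move=> /(congr1 Im); case: (A 0 0) => x y /=; lra.
have e3 : (u *m (bC *m bC^T) *m uH) 0 0 =
    (u *m bC) 0 0 * ((u *m bC) 0 0)^*%C.
  have -> : u *m (bC *m bC^T) *m uH = (u *m bC) *m (map_mx (@conjc R) (u *m bC))^T.
    by rewrite map_mxM real_conj trmx_mul !mulmxA.
  by rewrite mxE big_ord1 !mxE.
have mxD (A B D : 'M[C]_1) : (A - B + t *: D) 0 0 = A 0 0 - B 0 0 + t * D 0 0.
  by rewrite !mxE.
have : (u *m (diag_mx z - MC + t *: (bC *m bC^T)) *m uH) 0 0 = 0.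
  by rewrite uX mul0mx mxE.
rewrite mulmxDr mulmxBr mulmxDl mulmxBl -scalemxAr -scalemxAl.
move/(congr1 Im); rewrite mxD e1 e3 !Im_add Im_sum.
have -> (x : C) : Im (- x) = - Im x by case: x.
rewrite e2 oppr0 addr0 => e.
have ImM (x y : C) : Im (x * (y * y^*%C)) = Im x * (Re y ^+ 2 + Im y ^+ 2).
  by rewrite mulcJ_self; case: x => a c /=; ring.
have [v uv] : exists v, u 0 v != 0.
  by apply/existsP; apply: contraR u0 => /existsPn h; apply/eqP/rowP => v;
     rewrite mxE; apply/eqP/negPn/h.
have : 0 < \sum_v Im (z 0 v * (u 0 v * (u 0 v)^*%C)) +
    Im (t * ((u *m bC) 0 0 * ((u *m bC) 0 0)^*%C)).
  rewrite ltr_pwDl //; last by rewrite ImM mulr_ge0 // addr_ge0 ?sqr_ge0.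
  rewrite (bigD1 v) //= ltr_pwDl //; first by rewrite ImM mulr_gt0 ?norm2_gt0.
  by apply: sumr_ge0 => w _; rewrite ImM mulr_ge0 ?addr_ge0 ?sqr_ge0 // ltW.
by rewrite e ltxx.
Qed.

End Stability.

(** * Determinants on the diagonal *)

(** The determinant of the block matrix [B] is computed twice, by clearing [w] and by clearing
    [- u]. The second elimination multiplies by [\adj X] instead of an inverse, which leaves the
    nonzero factor [\det (\adj X) * \det X] to cancel. *)
Lemma det_rank1_update_regular (D : idomainType) n (X : 'M[D]_n) (u : 'cV[D]_n)
    (w : 'rV[D]_n) : \det X != 0 ->
  \det (X + u *m w) = \det X + (w *m \adj X *m u) 0 0.
Proof.
move=> X0; pose B := block_mx X (- u) w (1%:M : 'M_1).
have detB : \det B = \det (X + u *m w).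
  have := congr1 determinant
    (mulmx_block X (- u) w 1%:M (1%:M : 'M_n) 0 (- w) (1%:M : 'M_1)).
  rewrite det_mulmx det_lblock !det1 !mulr1 !mul1mx !mulmx1 !mulmx0 !add0r.
  by rewrite mulNmx mulmxN opprK subrr det_ublock det1 mulr1.
have a0 : \det (\adj X) != 0.
  have := congr1 determinant (mul_adj_mx X).
  rewrite det_mulmx det_scalar => e.
  by move: (expf_neq0 n X0); rewrite -e mulf_eq0 negb_or => /andP[].
rewrite -detB; pose a := \adj X *m u.
have e1 := mulmx_block (\adj X) 0 0 (1%:M : 'M_1) X (- u) w 1%:M.
have e2 := mulmx_block (\det X)%:M (- a) w (1%:M : 'M_1) (1%:M : 'M_n) a 0 (\det X)%:M.
move: e1 e2; rewrite !mul0mx !mul1mx !mulmx0 !addr0 !add0r mul_adj_mx mulmxN -/a.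
rewrite !mulmx1 ?addr0 ?mul1mx mul_scalar_mx mul_mx_scalar scalerN subrr => e1.
move/(congr1 determinant); rewrite -e1 !det_mulmx !det_ublock det_lblock !det1 mulr1.
rewrite mul1r -/B !det_scalar expr1 det_mx11.
have -> : (\det X) ^+ n = \det (\adj X) * \det X.
  by rewrite -det_mulmx mul_adj_mx det_scalar.
move=> e; apply: (mulfI (mulf_neq0 a0 X0)).
rewrite -mulmxA -/a; move: e; rewrite !mxE eqxx mulr1n => e.
by rewrite mulrAC e addrC.
Qed.

(* The identity is polynomial in [X], so it may be checked on ['X%:M + X],
   whose determinant is monic. *)
Lemma det_rank1_update (F : fieldType) n (X : 'M[F]_n) (u : 'cV[F]_n)
    (w : 'rV[F]_n) :
  \det (X + u *m w) = \det X + (w *m \adj X *m u) 0 0.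
Proof.
pose Y := char_poly_mx (- X).
have Y0 : \det Y != 0 by apply/monic_neq0/char_poly_monic.
have := det_rank1_update_regular (map_mx polyC u) (map_mx polyC w) Y0.
move/(congr1 (horner_eval 0)).
have YX : map_mx (horner_eval (0 : F)) Y = X.
  apply/matrixP=> i j; rewrite !mxE /horner_eval !hornerE.
  by rewrite hornerMn hornerX mul0rn add0r opprK.
have CK m p (A : 'M[F]_(m, p)) : map_mx (horner_eval 0) (map_mx polyC A) = A.
  by apply/matrixP=> i j; rewrite !mxE /horner_eval hornerC.
rewrite rmorphD -!det_map_mx map_mxD map_mxM !CK YX => ->; congr (_ + _).
have <- : map_mx (horner_eval 0) (map_mx polyC w *m \adj Y *m map_mx polyC u) =
    w *m \adj X *m u.
  by rewrite !map_mxM !CK map_mx_adj YX.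
by rewrite [in RHS]mxE.
Qed.

(** * Choosing the signs *)

Section DiagonalDeterminant.

Variables (K : fieldType) (n : nat).
Implicit Types (M : 'M[K]_n) (b : 'cV[K]_n) (y : 'rV[K]_n).

Definition diag_det M y : K := \det (diag_mx y - M).

Definition adj_form b M y : K := (b^T *m \adj (diag_mx y - M) *m b) 0 0.

Lemma diag_det_rank1 M b t y :
  diag_det (M - t *: (b *m b^T)) y = diag_det M y + t * adj_form b M y.
Proof.
rewrite /diag_det opprB addrCA addrC scalemxAl det_rank1_update; congr (_ + _).
by rewrite /adj_form -scalemxAr mxE.
Qed.

Lemma diag_det_shift M y v t :
  diag_det M (y + t *: delta_mx 0 v) =
    diag_det M y + t * (\adj (diag_mx y - M)) v v.
Proof.
rewrite /diag_det.
have -> : diag_mx (y + t *: delta_mx 0 v) - M =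
    diag_mx y - M + (t *: delta_mx v (0 : 'I_1)) *m delta_mx 0 v.
  rewrite -scalemxAl mul_delta_mx; apply/matrixP=> i j; rewrite !mxE eqxx /=.
  have [->|ij] := eqVneq i j; first by rewrite !mulr1n andbb; ring.
  rewrite !mulr0n; have [ei|_] := eqVneq i v; last by rewrite mulr0 addr0.
  by rewrite -ei eq_sym (negbTE ij) mulr0 addr0.
by rewrite det_rank1_update -scalemxAr -rowE -colE !mxE.
Qed.

Lemma pdiff_diag_det M v y :
  pdiff v (diag_det M) y = (\adj (diag_mx y - M)) v v.
Proof. by rewrite /pdiff -[delta_mx 0 v]scale1r diag_det_shift; ring. Qed.

Lemma multiaffine_diag_det M : multiaffine (diag_det M).
Proof. by move=> y v t; rewrite diag_det_shift pdiff_diag_det. Qed.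

Lemma multiaffine_adj_form b M : multiaffine (adj_form b M).
Proof.
have e y : adj_form b M y = diag_det (M - 1 *: (b *m b^T)) y - diag_det M y.
  by rewrite diag_det_rank1; ring.
by move=> y v t; rewrite /pdiff !e !multiaffine_diag_det /pdiff; ring.
Qed.

Lemma adj_form_sum b M y :
  adj_form b M y =
    \sum_(u : 'I_n * 'I_n) (b u.1 0 * b u.2 0) * (\adj (diag_mx y - M)) u.1 u.2.
Proof.
rewrite /adj_form mxE.
under eq_bigr do rewrite mxE mulr_suml.
rewrite exchange_big pair_big /=; apply: eq_bigr => u _.
by rewrite !mxE; ring.
Qed.

End DiagonalDeterminant.

(** * Averaging over sign vectors *)

Section SignVectors.

Variables (R : realFieldType) (n : nat).

Definition sign_vec (e : {set 'I_n}) (sg : {ffun 'I_n -> bool}) : 'cV[R]_n :=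
  \col_v (if v \in e then (-1) ^+ sg v else 0).

(** For [u != v], flipping the sign at [u] permutes the sign assignments and negates the sum, which
    is therefore 0. *)
Lemma sum_sign_vec e (u v : 'I_n) :
  \sum_sg sign_vec e sg u 0 * sign_vec e sg v 0 =
    ((u == v) && (u \in e))%:R *+ #|{ffun 'I_n -> bool}|.
Proof.
have [<-|uv] := eqVneq u v.
  rewrite -sumr_const; apply: eq_bigr => sg _; rewrite !mxE /=.
  by case: (u \in e); rewrite ?mulr0 // -expr2 sqrr_sign.
rewrite mul0rn; pose flip (sg : {ffun 'I_n -> bool}) :=
  [ffun w => if w == u then ~~ sg w else sg w].
have flipK : involutive flip.
  by move=> sg; apply/ffunP=> w; rewrite !ffunE; case: eqP; rewrite ?negbK.
set S := LHS; suff : S = - S by lra.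
rewrite {1}/S (reindex_inj (inv_inj flipK)) /= -sumrN; apply: eq_bigr => sg _.
rewrite !mxE !ffunE eqxx eq_sym (negbTE uv) -mulNr; congr (_ * _).
by case: (u \in e); rewrite ?oppr0 // signrN.
Qed.

(** By [sum_sign_vec] the right side is the average of the left side over all [sg]. *)
Lemma exists_sign_vec_le e (B : 'I_n * 'I_n -> R) :
  exists sg, \sum_u (sign_vec e sg u.1 0 * sign_vec e sg u.2 0) * B u
    <= \sum_(v in e) B (v, v).
Proof.
apply/existsP; rewrite -[X in is_true X]negbK; apply/negP => /existsPn h.
have : \sum_(sg : {ffun 'I_n -> bool}) \sum_(v in e) B (v, v) <
  \sum_sg \sum_u (sign_vec e sg u.1 0 * sign_vec e sg u.2 0) * B u.
  apply: ltr_sum => [|sg _]; last by rewrite ltNge h.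
  by apply/hasP; exists [ffun=> true]; rewrite ?mem_index_enum.
rewrite sumr_const [X in _ < X]exchange_big /=.
under [X in _ < X]eq_bigr do rewrite -mulr_suml sum_sign_vec.
rewrite [X in _ < X](_ : _ = (\sum_(v in e) B (v, v)) *+ #|{ffun 'I_n -> bool}|)
  ?ltxx //.
transitivity (\sum_u \sum_v
    ((u == v) && (u \in e))%:R *+ #|{ffun 'I_n -> bool}| * B (u, v)).
  by rewrite pair_bigA; apply: eq_bigr => -[].
rewrite -sumrMnl [RHS]big_mkcond /=; apply: eq_bigr => u _.
rewrite (bigD1 u) //= eqxx big1 ?addr0 => [|v vu].
  by case: (u \in e); rewrite ?mul0rn ?mul0r // mulr_natl.
by rewrite eq_sym (negbTE vu) mul0rn mul0r.
Qed.

End SignVectors.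

(** * Positivity and monotonicity on an orthant *)

Section Orthant.

Variables (R : realFieldType) (n : nat) (x0 : R).
Implicit Types (F q p : 'rV[R]_n -> R) (y : 'rV[R]_n).

Definition orthant y := forall v, x0 <= y 0 v.

Lemma orthant_shift y v t : orthant y -> 0 <= t -> orthant (y + t *: delta_mx 0 v).
Proof.
move=> oy t0 u; rewrite !mxE eqxx /= (le_trans (oy u)) // lerDl.
by rewrite mulr_ge0 ?ler0n.
Qed.

Lemma orthant_const : orthant (const_mx x0).
Proof. by move=> v; rewrite mxE. Qed.

Lemma orthant_ind (P : 'rV[R]_n -> Prop) :
  P (const_mx x0) ->
  (forall y v t, orthant y -> 0 <= t -> P y -> P (y + t *: delta_mx 0 v)) ->
  forall y, orthant y -> P y.
Proof.
move=> P0 PS y oy.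
have : forall s : seq 'I_n,
    let z := \sum_(v <- s) (y 0 v - x0) *: delta_mx 0 v in
    orthant (const_mx x0 + z) /\ P (const_mx x0 + z).
  elim=> [|v s [oz Pz]].
    by rewrite /= big_nil addr0; split; [exact: orthant_const|].
  have yv : 0 <= y 0 v - x0 by rewrite subr_ge0.
  rewrite /= big_cons addrCA addrC; split; first exact: orthant_shift.
  exact: PS.
move/(_ (index_enum _)) => [_].
rewrite (_ : const_mx x0 + _ = y) //; apply/rowP=> u.
rewrite !mxE summxE (bigD1 u) //= big1 ?addr0 => [|v vu].
  by rewrite !mxE !eqxx mulr1; ring.
by rewrite !mxE eq_sym (negbTE vu) andbF mulr0.
Qed.

Lemma pdiff_ge0 F v y : multiaffine F -> (forall z, orthant z -> 0 <= F z) ->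
  orthant y -> 0 <= pdiff v F y.
Proof.
move=> aF F0 oy; rewrite leNgt; apply/negP => d0.
(* Chosen so that moving by [t] in direction [v] brings [F] down to exactly -1. *)
pose t := (F y + 1) / - pdiff v F y.
have t0 : 0 <= t by rewrite divr_ge0 ?addr_ge0 ?F0 // oppr_ge0 ltW.
have := F0 _ (orthant_shift v oy t0); rewrite aF.
have -> : t * pdiff v F y = - (F y + 1).
  by rewrite /t invrN mulrN mulNr divfK ?lt_eqF.
by lra.
Qed.

(* Induction on the variables on which [F] depends: [edge_op] commutes with the
   derivatives of [F], which have one variable less. *)
Lemma edge_op_ge0 e F y : multiaffine F ->
  (forall z, orthant z -> 0 <= edge_op e F z) -> orthant y -> 0 <= F y.
Proof.
suff : forall (A : {set 'I_n}) F, multiaffine F ->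
    (forall v z, v \notin A -> pdiff v F z = 0) ->
    (forall z, orthant z -> 0 <= edge_op e F z) ->
    forall z, orthant z -> 0 <= F z.
  by move=> h aF F0; apply: (h setT) => // v z; rewrite inE.
move=> A; have [k] := ubnP #|A|.
elim: k A => // k IH A leA {}F aF FA F0 z oz.
have := F0 z oz; rewrite /edge_op subr_ge0; apply: le_trans.
apply: sumr_ge0 => v _; have [vA|vA] := boolP (v \in A); last by rewrite FA.
apply: (IH (A :\ v)) => // [||u w|w ow].
- by rewrite (cardsD1 v A) vA in leA.
- exact: multiaffine_pdiff.
- rewrite !inE negb_and negbK => /orP[/eqP ->|uA].
    by rewrite {1}/pdiff -[delta_mx 0 v]scale1r pdiff_multiaffine_id // subrr.
  by rewrite pdiffC {1}/pdiff !FA // subrr.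
rewrite -pdiff_edge_op; apply: pdiff_ge0 => //.
exact: multiaffine_edge_op.
Qed.

(** [F y] exceeds the sum of its derivatives over [e]. Each of these is nonnegative by
    [edge_op_ge0], since its image under [edge_op e] is a derivative of a multiaffine function that
    is positive on the orthant. *)
Lemma edge_op_gt0 e F y : multiaffine F ->
  (forall z, orthant z -> 0 < edge_op e F z) -> orthant y -> 0 < F y.
Proof.
move=> aF F0 oy; have := F0 y oy; rewrite /edge_op subr_gt0; apply: le_lt_trans.
apply: sumr_ge0 => v _; apply: (@edge_op_ge0 e) => // [|z oz].
  exact: multiaffine_pdiff.
rewrite -pdiff_edge_op; apply: pdiff_ge0 => //.
  exact: multiaffine_edge_op.
by move=> w ow; apply/ltW/F0.
Qed.

(* [p / q] is nonincreasing in every variable. *)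
Lemma rayleigh_lt q p : multiaffine q -> multiaffine p ->
  (forall y, orthant y -> 0 < q y) ->
  (forall y v, q y * pdiff v p y <= p y * pdiff v q y) ->
  p (const_mx x0) < q (const_mx x0) -> forall y, orthant y -> p y < q y.
Proof.
move=> aq ap q0 ray pq; apply: orthant_ind => // y v t oy t0 {}pq.
have qt := q0 _ (orthant_shift v oy t0).
rewrite -(ltr_pM2l (q0 y oy)).
apply: (@le_lt_trans _ _ (p y * q (y + t *: delta_mx 0 v))); last by rewrite ltr_pM2r.
rewrite ap aq; have := ler_wpM2l t0 (ray y v).
by move: (pdiff v p y) (pdiff v q y) => a c; lra.
Qed.

End Orthant.

(** * Fixing the signs one edge at a time *)

Section Signing.

Variables (R : rcfType) (n : nat) (x0 : R).
Implicit Types (M : 'M[R]_n) (b : 'cV[R]_n) (s : seq {set 'I_n}).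

(** Over the complex numbers, the first function plus [t] times the second is the image of
    [diag_det (M - t b b^T)], which is stable for [0 <= Im t]. *)
Lemma rayleigh_diag_det s M b y v : M^T = M ->
  edge_ops s (diag_det M) y * pdiff v (edge_ops s (adj_form b M)) y <=
  edge_ops s (adj_form b M) y * pdiff v (edge_ops s (diag_det M)) y.
Proof.
move=> sM; pose toC := real_complex R.
pose MC := map_mx toC M; pose bC := map_mx toC b.
apply: (@rayleigh_real _ _ _ _ (edge_ops s (diag_det MC))
  (edge_ops s (adj_form bC MC))).
- exact/multiaffine_edge_ops/multiaffine_diag_det.
- exact/multiaffine_edge_ops/multiaffine_adj_form.
- apply: edge_ops_map => x.
  by rewrite /diag_det -det_map_mx map_mxB map_diag_mx.
- apply: edge_ops_map => x; rewrite /adj_form.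
  rewrite -(map_diag_mx (real_complex R)) -map_mxB -map_mx_adj.
  have -> : bC^T = map_mx toC b^T by apply/matrixP=> i j; rewrite !mxE.
  by rewrite -!map_mxM [in RHS]mxE.
move=> z t uz t0; rewrite -edge_ops_affine.
rewrite (eq_edge_ops _ (fun w => esym (diag_det_rank1 MC bC t w))).
suff : stable (diag_det (MC - t *: (bC *m bC^T))).
  by case/(@stable_edge_ops _ _ s) => _; apply.
split=> [|w uw]; first exact: multiaffine_diag_det.
rewrite /diag_det opprB addrCA addrC; exact: det_diag_rank1_neq0.
Qed.

Lemma exists_sign_vec_gt0 e s M : M^T = M ->
  (forall y, orthant x0 y -> 0 < edge_ops (e :: s) (diag_det M) y) ->
  exists sg, forall y, orthant x0 y ->
    0 < edge_ops s (diag_det (M + sign_vec R e sg *m (sign_vec R e sg)^T)) y.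
Proof.
move=> sM h; pose y0 : 'rV[R]_n := const_mx x0.
(* At the corner [y0], [edge_ops s (adj_form b M)] is the quadratic form in [b] with coefficients
   [B]. Its average over the signs is what the operator of [e] subtracts from
   [edge_ops s (diag_det M)]. *)
pose B u := edge_ops s (fun y => (\adj (diag_mx y - M)) u.1 u.2) y0.
have [sg le_sg] := exists_sign_vec_le e B; exists sg.
set b := sign_vec R e sg.
have aq : multiaffine (edge_ops s (diag_det M)).
  exact/multiaffine_edge_ops/multiaffine_diag_det.
have ap : multiaffine (edge_ops s (adj_form b M)).
  exact/multiaffine_edge_ops/multiaffine_adj_form.
have hop y : edge_ops (e :: s) (diag_det M) y = edge_op e (edge_ops s (diag_det M)) y.
  exact: edge_opsC.
have q0 y : orthant x0 y -> 0 < edge_ops s (diag_det M) y.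
  by apply: (@edge_op_gt0 _ _ _ e) => // z; rewrite -hop; apply: h.
have eb y : edge_ops s (diag_det (M + b *m b^T)) y =
    edge_ops s (diag_det M) y - edge_ops s (adj_form b M) y.
  rewrite -[X in _ - X]mul1r -mulNr -edge_ops_affine; apply: eq_edge_ops => z.
  by rewrite -diag_det_rank1 scaleN1r opprK.
move=> y oy; rewrite eb subr_gt0; move: y oy.
apply: rayleigh_lt => // [y v|]; first exact: rayleigh_diag_det.
have := h _ (@orthant_const _ n x0); rewrite -/y0.
rewrite (_ : edge_ops (e :: s) _ y0 =
  edge_ops s (diag_det M) y0 - \sum_(v in e) B (v, v)).
  rewrite subr_gt0; apply: le_lt_trans; apply: le_trans le_sg.
  by rewrite (eq_edge_ops _ (adj_form_sum b M)) edge_ops_sum.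
rewrite /= -[X in _ - X]mul1r -mulNr.
have -> : \sum_(v in e) B (v, v) =
  edge_ops s (fun y => \sum_(v in e) 1 * (\adj (diag_mx y - M)) v v) y0.
  by rewrite edge_ops_sum; apply: eq_bigr => v _; rewrite mul1r.
rewrite -edge_ops_affine; apply: eq_edge_ops => y.
rewrite /edge_op mulN1r; congr (_ - _).
by apply: eq_bigr => v _; rewrite pdiff_diag_det mul1r.
Qed.

Lemma exists_signing_gt0 (E : eqType) (edges : E -> {set 'I_n}) (s : seq E) M :
  uniq s -> M^T = M ->
  (forall y, orthant x0 y -> 0 < edge_ops (map edges s) (diag_det M) y) ->
  exists sg : E -> {ffun 'I_n -> bool}, forall y, orthant x0 y ->
    0 < diag_det (M + \sum_(e <- s)
      sign_vec R (edges e) (sg e) *m (sign_vec R (edges e) (sg e))^T) y.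
Proof.
elim: s M => [|e s IH] M /=.
  by move=> _ _ h; exists (fun=> [ffun=> true]) => y; rewrite big_nil addr0; apply: h.
move=> /andP[es us] sM /(exists_sign_vec_gt0 sM)[tau h].
have [|sg hsg] := IH _ us _ h.
  by rewrite linearD /= sM trmx_mul trmxK.
exists (fun f => if f == e then tau else sg f) => y oy.
rewrite big_cons eqxx addrA (eq_big_seq (fun f =>
  sign_vec R (edges f) (sg f) *m (sign_vec R (edges f) (sg f))^T)); first exact: hsg.
by move=> f fs /=; case: eqP => // ef; rewrite -ef fs in es.
Qed.

End Signing.

(** * The matching polynomial *)

Section MatchingPolynomial.

Variable n : nat.

(* The signed sum of [\prod_(v in A, v unmatched) y_v] over the matchings of the
   incidence graph between [A] and [s]. *)
Definition matching_poly (K : comNzRingType) (A : {set 'I_n}) (s : seq {set 'I_n})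
    (y : 'rV[K]_n) : K :=
  edge_ops s (fun z : 'rV[K]_n => \prod_(v in A) z 0 v) y.

(** Either [e] is unmatched or it is matched to some [v]: differentiating the squarefree monomial in
    [y_v] deletes [v] from [A]. *)
Lemma matching_poly_edge (K : comNzRingType) A e s (y : 'rV[K]_n) :
  matching_poly A (e :: s) y =
    matching_poly A s y - \sum_(v in e :&: A) matching_poly (A :\ v) s y.
Proof.
pose F (v : 'I_n) (z : 'rV[K]_n) := \prod_(u in A :\ v) z 0 u.
have pdE (v : 'I_n) (z : 'rV[K]_n) :
    pdiff v (fun z => \prod_(u in A) z 0 u) z = if v \in A then F v z else 0.
  rewrite /pdiff; case: ifPn => vA; last first.
    rewrite (eq_bigr (fun u => z 0 u)) ?subrr // => u uA.
    rewrite !mxE eqxx /=; case: eqP => [uv|_]; last by rewrite addr0.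
    by rewrite -uv uA in vA.
  rewrite !(big_setD1 v vA) /= -/(F v z) (eq_bigr (fun u => z 0 u)).
    by rewrite !mxE !eqxx -/(F v z) /=; ring.
  by move=> u; rewrite !inE !mxE eqxx => /andP[/negbTE -> _]; rewrite addr0.
rewrite /matching_poly /= -mulN1r.
have -> : \sum_(v in e :&: A)
    edge_ops s (fun z : 'rV[K]_n => \prod_(u in A :\ v) z 0 u) y
    = edge_ops s (fun z => \sum_(v in e :&: A) 1 * F v z) y.
  by rewrite edge_ops_sum; apply: eq_bigr => v _; rewrite mul1r.
rewrite -edge_ops_affine; apply: eq_edge_ops => z; rewrite /edge_op mulN1r.
congr (_ - _); under eq_bigr do rewrite pdE.
rewrite -big_mkcondr /=; apply: eq_big => [u|u _]; first by rewrite inE.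
by rewrite mul1r.
Qed.

Lemma matching_poly_perm (K : comNzRingType) A s t (y : 'rV[K]_n) :
  perm_eq s t -> matching_poly A s y = matching_poly A t y.
Proof. by move=> st; apply: edge_ops_perm. Qed.

Lemma matching_poly_set0 (K : comNzRingType) s (y : 'rV[K]_n) :
  matching_poly set0 s y = 1.
Proof.
elim: s => [|e s IH]; first by rewrite /matching_poly /= big_set0.
by rewrite matching_poly_edge IH setI0 big_set0 subr0.
Qed.

(** The dual expansion: [v] is unmatched and contributes [y 0 v], or it is matched to an edge of
    [s]. *)
Lemma matching_poly_vertex (K : comNzRingType) (A : {set 'I_n}) v s
    (y : 'rV[K]_n) : v \in A ->
  matching_poly A s y = y 0 v * matching_poly (A :\ v) s y
    - \sum_(e <- s | v \in e) matching_poly (A :\ v) (rem e s) y.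
Proof.
elim: s A => [|f s IH] A vA.
  by rewrite big_nil subr0 /matching_poly /= (big_setD1 v vA).
(* A vertex set may be repeated in the list, so [e] can equal [f]; removing either copy gives the
   same list up to permutation. *)
have rest : \sum_(e <- s | v \in e) matching_poly (A :\ v) (rem e (f :: s)) y =
    \sum_(e <- s | v \in e) matching_poly (A :\ v) (rem e s) y -
    \sum_(u in f :&: (A :\ v)) \sum_(e <- s | v \in e)
      matching_poly (A :\ v :\ u) (rem e s) y.
  rewrite exchange_big -sumrB big_seq_cond [RHS]big_seq_cond.
  apply: eq_bigr => e /andP[es _]; rewrite -matching_poly_edge.
  apply: matching_poly_perm; rewrite /=; case: eqP => // ->.
  exact: perm_to_rem.
have vert : \sum_(u in f :&: A) matching_poly (A :\ u) s y =
    (if v \in f then matching_poly (A :\ v) s y else 0) +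
    \sum_(u in f :&: (A :\ v)) matching_poly (A :\ u) s y.
  case: ifPn => vf; last first.
    rewrite add0r; apply: eq_bigl => u; rewrite !inE.
    by case: eqP => // ->; rewrite (negbTE vf).
  rewrite (big_setD1 v) ?inE ?vf //=; congr (_ + _); apply: eq_bigl => u.
  by rewrite !inE; case: (u == v); rewrite ?andbF.
rewrite !matching_poly_edge vert (IH A vA).
under [X in _ - (_ + X)]eq_bigr => u.
  rewrite !inE => /and3P[_ uv uA]; rewrite (IH (A :\ u)) ?inE ?vA ?andbT 1?eq_sym //.
  rewrite setDDl setUC -setDDl; over.
rewrite sumrB -mulr_sumr big_cons rest /= eqxx; case: (v \in f); ring.
Qed.

End MatchingPolynomial.

(** * Heilmann-Lieb bounds for the matching polynomial *)

Section MatchingPolynomialPositivity.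

Variables (R : realFieldType) (n d1 r1 : nat) (a c : R) (y : 'rV[R]_n).
Hypotheses (a0 : 0 < a) (c0 : 0 < c) (ac1 : 1 <= a * c).
Hypotheses (aE : a ^+ 2 = d1%:R) (cE : c ^+ 2 = r1%:R).
Hypothesis y_gt : forall v, (a + c) ^+ 2 < y 0 v.

(* Heilmann-Lieb recursion. The two ratio bounds are the fixed point of the
   recursion on the infinite biregular tree, at the edge of its spectrum. *)
Lemma matching_poly_bounds A (s : seq {set 'I_n}) :
  (forall v, count (fun e : {set 'I_n} => v \in e) s <= d1.+1)%N ->
  (forall e : {set 'I_n}, e \in s -> #|e| <= r1.+1)%N ->
  [/\ 0 < matching_poly A s y,
      forall v, v \in A -> (count (fun e : {set 'I_n} => v \in e) s <= d1)%N ->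
        matching_poly (A :\ v) s y <= (c * (a + c))^-1 * matching_poly A s y
    & forall e : {set 'I_n}, e \in s -> (#|e :&: A| <= r1)%N ->
        matching_poly A (rem e s) y <= (a + c) / a * matching_poly A s y].
Proof.
have [k] := ubnP (#|A| + size s)%N; elim: k A s => // k IH A s leK degs cards.
have s0 : 0 < a + c by rewrite addr_gt0.
(* Once [v] is deleted, an edge through [v] has at most [r1] vertices left, so the third bound holds
   for it by induction. *)
have vert v : v \in A -> 0 < matching_poly (A :\ v) s y /\
    \sum_(e <- s | v \in e) matching_poly (A :\ v) (rem e s) y <=
    (count (fun e : {set 'I_n} => v \in e) s)%:R *
    ((a + c) / a * matching_poly (A :\ v) s y).
  move=> vA; have [|m0 _ h] := IH (A :\ v) s _ degs cards.
    by move: leK; rewrite (cardsD1 v A) vA.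
  split=> //; rewrite -sum1_count natr_sum mulr_suml.
  rewrite big_seq_cond [leRHS]big_seq_cond; apply: ler_sum => e /andP[es ve].
  rewrite mul1r; apply: h => //; rewrite -ltnS; apply: leq_trans (cards e es).
  apply/proper_card/properP; split; first exact: subsetIl.
  by exists v; rewrite // !inE eqxx andbF.
split.
- have [->|[v vA]] := set_0Vmem A; first by rewrite matching_poly_set0.
  have [m0 hs] := vert v vA; rewrite (matching_poly_vertex s y vA) subr_gt0.
  apply: (le_lt_trans hs); rewrite mulrA ltr_pM2r //.
  apply: le_lt_trans (y_gt v).
  (* Here [v] may have [d1 + 1 = a ^+ 2 + 1] edges, one more than in the ratio bound; [1 <= a * c]
     absorbs the excess. *)
  apply: (@le_trans _ _ ((a ^+ 2 + 1) * ((a + c) / a))).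
    apply: ler_wpM2r; first by rewrite divr_ge0 ?ltW.
    by rewrite aE natr1 ler_nat degs.
  rewrite mulrA ler_pdivrMr // -subr_ge0.
  have -> : (a + c) ^+ 2 * a - (a ^+ 2 + 1) * (a + c) = (a + c) * (a * c - 1) by ring.
  by rewrite mulr_ge0 ?subr_ge0 // ltW.
(* With at most [a ^+ 2] edges at [v], the gain is at least
   [(a + c) ^+ 2 - a * (a + c) = c * (a + c)]. *)
- move=> v vA dv; have [m0 hs] := vert v vA.
  rewrite ler_pdivlMl ?mulr_gt0 // (matching_poly_vertex s y vA).
  have : \sum_(e <- s | v \in e) matching_poly (A :\ v) (rem e s) y <=
      a ^+ 2 * ((a + c) / a * matching_poly (A :\ v) s y).
    apply: (le_trans hs); rewrite ler_wpM2r ?aE ?ler_nat //.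
    by rewrite mulr_ge0 ?divr_ge0 ?ltW.
  have -> : a ^+ 2 * ((a + c) / a * matching_poly (A :\ v) s y) =
      a * (a + c) * matching_poly (A :\ v) s y.
    by field; rewrite gt_eqF.
  have : (a + c) ^+ 2 * matching_poly (A :\ v) s y <= y 0 v * matching_poly (A :\ v) s y.
    by rewrite ler_pM2r // ltW.
  by lra.
(* Without [e], each of its vertices has at most [d1] edges, so the second bound applies and the
   gain is at least [1 - c / (a + c) = a / (a + c)]. *)
move=> e es le_e; pose s' := rem e s.
have ps : perm_eq s (e :: s') := perm_to_rem es.
have [||f fs|m0 hv _] := IH A s'.
- by move: leK; rewrite (perm_size ps) /= addnS.
- by move=> v; apply: leq_trans (degs v); rewrite (seq.permP ps) /= leq_addl.
- by apply/cards/(mem_rem fs).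
rewrite (matching_poly_perm A y ps) matching_poly_edge -/s'.
have : \sum_(v in e :&: A) matching_poly (A :\ v) s' y <=
    c ^+ 2 * ((c * (a + c))^-1 * matching_poly A s' y).
  apply: (@le_trans _ _ (\sum_(v in e :&: A) (c * (a + c))^-1 * matching_poly A s' y)).
    apply: ler_sum => v /setIP[ve vA]; apply: hv => //.
    by rewrite -ltnS; apply: leq_trans (degs v); rewrite (seq.permP ps) /= ve.
  rewrite sumr_const -mulr_natl ler_wpM2r ?cE ?ler_nat //.
  by rewrite mulr_ge0 ?invr_ge0 ?mulr_ge0 ?ltW.
have -> : c ^+ 2 * ((c * (a + c))^-1 * matching_poly A s' y) =
    c / (a + c) * matching_poly A s' y.
  by field; rewrite !gt_eqF.
move=> hs; rewrite -[leLHS](_ : (a + c) / a * (matching_poly A s' y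
    - c / (a + c) * matching_poly A s' y) = _); last by field; rewrite !gt_eqF.
apply: ler_wpM2l; first by rewrite divr_ge0 ?ltW.
by rewrite lerD2l lerN2.
Qed.

End MatchingPolynomialPositivity.

(** * Signed covers *)

Lemma det_reindex (K : comNzRingType) m p (A : 'M[K]_m) (B : 'M[K]_p)
    (f : 'I_m -> 'I_p) :
  bijective f -> (forall i j, B (f i) (f j) = A i j) -> \det A = \det B.
Proof.
move=> bf; have mp : m = p by have := bij_eq_card bf; rewrite !card_ord.
move: B f bf; rewrite -mp => B f bf eB; pose t := perm (bij_inj bf).
have -> : A = row_perm t (col_perm t B).
  by apply/matrixP=> i j; rewrite !mxE !permE eB.
rewrite row_permE col_permE !det_mulmx !det_perm odd_permV mulrCA.
by rewrite -expr2 sqrr_sign mulr1.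
Qed.

Lemma char_poly_reindex (K : comNzRingType) m p (A : 'M[K]_m) (B : 'M[K]_p)
    (f : 'I_m -> 'I_p) :
  bijective f -> (forall i j, B (f i) (f j) = A i j) -> char_poly A = char_poly B.
Proof.
move=> bf eB; apply: (det_reindex bf) => i j.
by rewrite !mxE eB (inj_eq (bij_inj bf)).
Qed.

Lemma det_block_sym (K : comNzRingType) m (X Y : 'M[K]_m) :
  \det (block_mx X Y Y X) = \det (X + Y) * \det (X - Y).
Proof.
have e1 := mulmx_block (1%:M : 'M_m) 1%:M 0 (1%:M : 'M_m) X Y Y X.
have e2 := mulmx_block (X + Y) (X + Y) Y X (1%:M : 'M_m) (- 1%:M) 0 (1%:M : 'M_m).
move: e1 e2; rewrite !mul1mx !mul0mx !add0r (addrC Y X) => e1.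
rewrite !mulmxN !mulmx1 !mulmx0 !addr0 addNr (addrC (- Y)) => e2.
have := congr1 determinant e2; rewrite -e1 !det_mulmx !det_ublock det_lblock.
by rewrite !det1 !mul1r !mulr1.
Qed.

Lemma char_poly_block_sym (K : comNzRingType) m (P Q : 'M[K]_m) :
  char_poly (block_mx P Q Q P) = char_poly (P + Q) * char_poly (P - Q).
Proof.
rewrite /char_poly.
have -> : char_poly_mx (block_mx P Q Q P) =
    block_mx (char_poly_mx P) (- map_mx polyC Q) (- map_mx polyC Q) (char_poly_mx P).
  rewrite /char_poly_mx map_block_mx scalar_mx_block.
  by rewrite opp_block_mx add_block_mx !add0r.
rewrite det_block_sym /char_poly_mx map_mxD map_mxB.
by rewrite !opprD !opprK !addrA.
Qed.

Lemma horner_char_poly (K : comNzRingType) m (A : 'M[K]_m) x :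
  (char_poly A).[x] = \det (x%:M - A).
Proof.
rewrite /char_poly -[LHS]/(horner_eval x _) -det_map_mx; congr (\det _).
apply/matrixP=> i j.
by rewrite !mxE /= /horner_eval hornerD hornerN hornerC hornerMn hornerX.
Qed.

Section SignedCover.

Variables (H : hypergraph) (sg : hyperedge H -> vertex H -> bool).

(** The 2-lift of the bipartite incidence graph of [H] given by the signing, read again as a
    hypergraph: an incidence with sign [true] joins opposite sheets. *)
Definition signed_cover : hypergraph :=
  @Hypergraph (vertex H * bool)%type (hyperedge H * bool)%type
    (fun e => [set v | (v.1 \in edge e.1) && (v.2 (+) sg e.1 v.1 == e.2)]).

Lemma signed_cover_is_cover : is_cover 2 signed_cover H.
Proof.
exists fst; split; last first.
  move=> v; transitivity #|[set (v, false); (v, true)]|; last first.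
    by rewrite cards2 xpair_eqE andbF.
  apply: eq_card => -[u b]; rewrite !inE !xpair_eqE /=.
  by case: b; rewrite ?andbT ?andbF ?orbF.
split=> [v|]; first by exists (v, false).
exists fst; split=> [[e c]|[v b]]; split.
- move=> [u a] [v b]; rewrite !inE /= => /andP[_ /eqP ha] /andP[_ /eqP hb] euv.
  by move: ha hb; rewrite -euv => <- /addIb ->.
- apply/setP=> v; apply/imsetP/idP => [[[u a] /=]|ve].
    by rewrite inE /= => /andP[ue _] ->.
  by exists (v, c (+) sg e v); rewrite // inE /= ve addbK eqxx.
- move=> [e a] [f c]; rewrite !inE /= => /andP[_ /eqP ha] /andP[_ /eqP hb] eef.
  by move: ha hb; rewrite -eef => -> ->.
apply/setP=> e; apply/imsetP/idP => [[[f a] /=]|ve].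
  by rewrite !inE /= => /andP[vf _] ->.
rewrite inE in ve.
by exists (e, b (+) sg e v); rewrite // !inE /= ve eqxx.
Qed.

Lemma card_signed_cover_edges u v a b :
  #|@edges_at signed_cover (u, a) :&: @edges_at signed_cover (v, b)| =
  #|[set e in edges_at u :&: edges_at v | a (+) sg e u == b (+) sg e v]|.
Proof.
rewrite -(card_imset _ (_ : injective (fun e => (e, a (+) sg e u)))); last first.
  by move=> e f [].
apply: eq_card => -[e c]; rewrite !inE /=; apply/idP/imsetP.
  move=> /andP[/andP[ue /eqP ac] /andP[ve /eqP bc]]; exists e; last by rewrite ac.
  by rewrite !inE ue ve ac bc eqxx.
move=> [f]; rewrite !inE => /andP[/andP[uf vf] /eqP ab] [-> ->].
by rewrite uf vf -ab !eqxx.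
Qed.

Variable R : realType.
Local Notation n := #|vertex H|.

(** The diagonal has to be set to 0, since the sign of a vertex agrees with itself on every edge; in
    [cross_sheet] it is 0 automatically. *)
Definition same_sheet : 'M[R]_n := \matrix_(i, j) (if i == j then 0 else
  #|[set e in edges_at (enum_val i) :&: edges_at (enum_val j) |
     sg e (enum_val i) == sg e (enum_val j)]|%:R).

Definition cross_sheet : 'M[R]_n := \matrix_(i, j)
  #|[set e in edges_at (enum_val i) :&: edges_at (enum_val j) |
     sg e (enum_val i) != sg e (enum_val j)]|%:R.

Lemma cross_sheet_diag i : cross_sheet i i = 0.
Proof.
rewrite mxE (_ : [set _ in _ | _] = set0) ?cards0 //.
by apply/setP=> e; rewrite !inE eqxx andbF.
Qed.

Lemma adjacency_sheets : adjacency_mx H R = same_sheet + cross_sheet.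
Proof.
apply/matrixP=> i j; rewrite [RHS]mxE.
have [<-|ij] := eqVneq i j; first by rewrite cross_sheet_diag !mxE eqxx addr0.
rewrite !mxE (negbTE ij) -natrD; congr (_%:R).
set A := _ :&: _; rewrite -(cardsID [set e | sg e (enum_val i) == sg e (enum_val j)] A).
by congr (_ + _)%N; apply: eq_card => e; rewrite !inE // andbC.
Qed.

(** Lists the sheet [false] before the sheet [true], which gives the adjacency matrix of the cover
    the form of [char_poly_block_sym]. *)
Definition lift_index (k : 'I_(n + n)) : 'I_#|vertex signed_cover| :=
  match split k with
  | inl i => enum_rank (enum_val i, false)
  | inr i => enum_rank (enum_val i, true)
  end.

Lemma lift_index_bij : bijective lift_index.
Proof.
apply: inj_card_bij; last by rewrite !card_ord /= card_prod card_bool muln2 addnn.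
move=> k l; rewrite /lift_index.
case: (split_ordP k) => i ->; case: (split_ordP l) => j ->.
- by move=> /enum_rank_inj [/enum_val_inj ->].
- by move=> /enum_rank_inj [].
- by move=> /enum_rank_inj [].
- by move=> /enum_rank_inj [/enum_val_inj ->].
Qed.

Lemma char_poly_signed_cover :
  char_poly (adjacency_mx signed_cover R) =
  char_poly (adjacency_mx H R) * char_poly (same_sheet - cross_sheet).
Proof.
rewrite adjacency_sheets -char_poly_block_sym; apply/esym.
apply: (char_poly_reindex lift_index_bij) => k l.
rewrite mxE (inj_eq (bij_inj lift_index_bij)) /lift_index.
have same (a : bool) (i j : 'I_n) : #|@edges_at signed_cover (enum_val i, a) :&:
    @edges_at signed_cover (enum_val j, a)|%:R = (#|[set e in edges_at (enum_val i)
     :&: edges_at (enum_val j) | sg e (enum_val i) == sg e (enum_val j)]|%:R : R).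
  rewrite card_signed_cover_edges; congr (_%:R); apply: eq_card => e.
  by rewrite !inE (can_eq (addKb a)).
have cross (a : bool) (i j : 'I_n) : #|@edges_at signed_cover (enum_val i, a) :&:
    @edges_at signed_cover (enum_val j, ~~ a)|%:R = cross_sheet i j.
  rewrite card_signed_cover_edges mxE; congr (_%:R); apply: eq_card => e.
  by rewrite !inE addNb -addbN (can_eq (addKb a)); case: (sg e _) (sg e _) => [] [].
case: (split_ordP k) => i ->; case: (split_ordP l) => j ->; rewrite !enum_rankK.
- by rewrite block_mxEul mxE (inj_eq (@lshift_inj _ _)) same.
- by rewrite block_mxEur eq_lrshift (cross false).
- by rewrite block_mxEdl eq_rlshift (cross true).
by rewrite block_mxEdr mxE (inj_eq (@rshift_inj _ _)) same.
Qed.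

End SignedCover.

(** * Signings of regular hypergraphs and the final bound *)

Section RegularHypergraph.

Variables (R : realType) (d r : nat) (H : hypergraph).
Hypothesis hreg : regular H d r.
Local Notation n := #|vertex H|.

Definition index_edge (e : hyperedge H) : {set 'I_n} :=
  [set i | enum_val i \in edge e].

Definition signed_gram (sg : hyperedge H -> {ffun 'I_n -> bool}) : 'M[R]_n :=
  \sum_e sign_vec R (index_edge e) (sg e) *m (sign_vec R (index_edge e) (sg e))^T.

Definition vertex_signs (sg : hyperedge H -> {ffun 'I_n -> bool}) e v :=
  sg e (enum_rank v).

(** Off the diagonal, both sides count the edges through two vertices with weight 1 if the signs
    agree and -1 otherwise. The diagonal of [signed_gram sg] counts the edges at a vertex, whence
    the term in [d]. *)
Lemma signed_gram_sheets sg :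
  same_sheet (vertex_signs sg) R - cross_sheet (vertex_signs sg) R =
  signed_gram sg - d%:R%:M.
Proof.
have [_ _ hd] := hreg; apply/matrixP=> i j.
have mxB (A B : 'M[R]_n) : (A - B) i j = A i j - B i j by rewrite !mxE.
rewrite !mxB summxE.
have gramE e : (sign_vec R (index_edge e) (sg e) *m
    (sign_vec R (index_edge e) (sg e))^T) i j =
    if e \in edges_at (enum_val i) :&: edges_at (enum_val j)
    then (-1) ^+ (sg e i (+) sg e j) else 0.
  rewrite mxE big_ord1 !mxE !inE signr_addb.
  by case: (_ \in edge e); case: (_ \in edge e); rewrite ?mul0r ?mulr0.
under eq_bigr do rewrite gramE.
rewrite -big_mkcond /=.
have [<-|ij] := eqVneq i j.
  rewrite cross_sheet_diag subr0 !mxE eqxx mulr1n setIid.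
  by under eq_bigr do rewrite addbb; rewrite sumr_const hd subrr.
rewrite !mxE (negbTE ij) mulr0n subr0.
set A := _ :&: _.
rewrite (bigID (fun e => sg e i == sg e j)) /=.
rewrite (eq_bigr (fun=> 1)) => [|e /andP[_ /eqP ->]]; last by rewrite addbb.
rewrite [X in _ = _ + X](eq_bigr (fun=> -1)) => [|e /andP[_]]; last first.
  by case: (sg e i) (sg e j) => [] [].
rewrite !sumr_const mulNrn; congr (_%:R - _%:R); apply: eq_card => e;
  by rewrite /vertex_signs !inE !enum_valK [in RHS]unfold_in !inE.
Qed.

Let a : R := Num.sqrt (d%:R - 1).
Let c : R := Num.sqrt (r%:R - 1).

(** The gap between [(a + c) ^+ 2] and [x0] gives the strict inequality of [matching_poly_bounds] on
    the whole closed orthant. *)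
Lemma exists_signing_above x0 : (2 <= d)%N -> (a + c) ^+ 2 < x0 ->
  exists sg, forall x, x0 <= x -> \det (x%:M - signed_gram sg) != 0.
Proof.
move=> hd hx0; have [hr card_e deg_v] := hreg.
have d1 : 1 <= d%:R - 1 :> R by move: hd; rewrite -(ler_nat R); lra.
have r1 : 1 <= r%:R - 1 :> R by move: hr; rewrite -(ler_nat R); lra.
have aE : a ^+ 2 = d.-1%:R.
  by rewrite sqr_sqrtr ?(le_trans ler01) // -subn1 natrB // ltnW.
have cE : c ^+ 2 = r.-1%:R.
  by rewrite sqr_sqrtr ?(le_trans ler01) // -subn1 natrB // ltnW.
have a1 : 1 <= a by rewrite -[1]sqrtr1 ler_wsqrtr.
have c1 : 1 <= c by rewrite -[1]sqrtr1 ler_wsqrtr.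
have := @exists_signing_gt0 R n x0 _ index_edge (enum (hyperedge H)) 0.
rewrite enum_uniq trmx0 => /(_ isT erefl)[y oy|sg h].
  have -> : edge_ops (map index_edge (enum (hyperedge H))) (diag_det 0) y =
      matching_poly setT (map index_edge (enum (hyperedge H))) y.
    apply: eq_edge_ops => z; rewrite /diag_det subr0 det_diag.
    by apply: eq_bigl => v; rewrite inE.
  have card_f e : #|index_edge e| = #|edge e|.
    rewrite -[RHS](card_imset _ (@enum_rank_inj _)); apply: eq_card => i.
    rewrite inE; apply/idP/imsetP => [ie|[v ve ->]]; last by rewrite enum_rankK.
    by exists (enum_val i); rewrite ?enum_valK.
  have [||||||//] := @matching_poly_bounds R n d.-1 r.-1 a c y _ _ _ aE cE _ setT
      (map index_edge (enum (hyperedge H))).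
  - exact: lt_le_trans a1.
  - exact: lt_le_trans c1.
  - by rewrite mulr_ege1.
  - by move=> v; apply: lt_le_trans (oy v).
  - move=> v; rewrite prednK ?(ltnW hd) // count_map -(deg_v (enum_val v)).
    rewrite enumT cardE /enum_mem size_filter; apply/eq_leq/eq_count => e.
    by rewrite /= !inE.
  - move=> e /mapP[f _ ->]; by rewrite card_f card_e prednK // ltnW.
exists sg => x xx0; have := h (const_mx x) (fun v => _).
rewrite /diag_det diag_const_mx add0r big_enum => ox.
by rewrite gt_eqF // ox // => v; rewrite mxE.
Qed.

(** There are finitely many signings. If each had a root above [(a + c) ^+ 2], the least of the
    chosen roots would be an [x0] contradicting [exists_signing_above]. *)
Lemma exists_ramanujan_signing : (2 <= d)%N ->
  exists sg, forall x, (a + c) ^+ 2 < x -> \det (x%:M - signed_gram sg) != 0.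
Proof.
move=> hd; apply: contrapT => none.
pose bad (sg : hyperedge H -> {ffun 'I_n -> bool}) x0 :=
  exists2 x, x0 <= x & \det (x%:M - signed_gram sg) = 0.
have bad_sg sg : exists2 x0, (a + c) ^+ 2 < x0 & bad sg x0.
  apply: contrapT => good; apply: none; exists sg => x hx; apply/eqP => dx.
  by apply: good; exists x => //; exists x.
have [x0 hx0 h] : exists2 x0, (a + c) ^+ 2 < x0 &
    forall sg, sg \in enum {ffun hyperedge H -> {ffun 'I_n -> bool}} -> bad sg x0.
  elim: (enum _) => [|sg s [x1 hx1 h1]].
    by exists ((a + c) ^+ 2 + 1) => //; rewrite ltrDl.
  have [x2 hx2 [x x2x dx]] := bad_sg sg.
  exists (Num.min x1 x2) => [|tau]; first by rewrite lt_min hx1.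
  rewrite inE => /orP[/eqP ->|/h1[z x1z dz]]; [exists x | exists z] => //.
    by rewrite ge_min x2x orbT.
  by rewrite ge_min x1z.
have [sg hsg] := exists_signing_above hd hx0.
have [|x x0x] := h [ffun e => sg e]; first by rewrite mem_enum.
rewrite (_ : signed_gram _ = signed_gram sg).
  by move/eqP; rewrite (negbTE (hsg x x0x)).
by apply: eq_bigr => e _; rewrite ffunE.
Qed.

End RegularHypergraph.

Theorem theorem1p6 (R : realType) (d r : nat) (H : hypergraph)
    (hd : (2 <= d)%N) (hreg : regular H d r) (hconn : connected H) :
  exists H' : hypergraph,
    is_cover 2 H' H /\
    forall x : R, new_eigenvalue H' H x ->
      x <= r%:R - 2 + 2 * Num.sqrt ((d%:R - 1) * (r%:R - 1)).
Proof.
have [sg hsg] := exists_ramanujan_signing R hreg hd.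
exists (signed_cover (vertex_signs sg)); split; first exact: signed_cover_is_cover.
move=> x; rewrite /new_eigenvalue /eigenvalue_mult char_poly_signed_cover.
rewrite mupM ?monic_neq0 ?char_poly_monic // addKn.
rewrite -XsubC_dvd ?monic_neq0 ?char_poly_monic //.
rewrite dvdp_XsubCl rootE (signed_gram_sheets R hreg) horner_char_poly => /eqP dx.
rewrite leNgt; apply/negP => ltx.
have [hr _ _] := hreg.
have d0 : 0 <= d%:R - 1 :> R by rewrite subr_ge0 ler1n ltnW.
have r0 : 0 <= r%:R - 1 :> R by rewrite subr_ge0 ler1n ltnW.
(* The shift by [d] turns [(a + c) ^+ 2], that is [d + r - 2] plus twice the square root of
   [(d - 1) * (r - 1)], into the required bound. *)
have /negP[] : \det ((x + d%:R)%:M - signed_gram R sg) != 0.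
  apply: hsg; rewrite sqrrD !sqr_sqrtr // -sqrtrM //; lra.
by rewrite raddfD /= -addrA -[_ - signed_gram _ _]opprB dx eqxx.
Qed.
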